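(* Let $r\ge0$ and $N\ge 3$. (1) Let $X:\mathbb{Z}^N\to\mathbb{G}^d_r$ be a Grassmannian Q-net of rank $r$ in general position, and let $b^{ij}\in\mathrm{Mat}(r+1,r+1)$ ($1\le i\ne j\le N$) be its discrete rotation coefficients (with respect to any choice of discrete Lamé coefficients). Then the $b^{ij}$ satisfy the noncommutative discrete Darboux system $$b^{ij}_k=(b^{ij}+b^{ik}b^{kj})(I-b^{jk}b^{kj})^{-1},\qquad i,j,k \text{ pairwise distinct.}$$ (2) This map is multidimensionally consistent: for $N\ge4$ and any matrices $b^{ij}\in\mathrm{Mat}(r+1,r+1)$, $1\le i\neq j\le N$, put $$b^{ij}_k:=(b^{ij}+b^{ik}b^{kj})(I-b^{jk}b^{kj})^{-1},\qquad b^{ij}_{kl}:=(b^{ij}_k+b^{il}_kb^{lj}_k)(I-b^{jl}_kb^{lj}_k)^{-1}$$ for pairwise distinct indices; then $b^{ij}_{kl}=b^{ij}_{lk}$ for all pairwise distinct $i,j,k,l$, whenever all the inverses involved exist.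
   Context: $\mathbb{G}^d_r$ is the Grassmannian of $r$-planes in the real projective space $\mathbb{P}^d$, identified with the variety of $(r+1)$-dimensional vector subspaces of $\mathbb{R}^{d+1}$; dimensions of spans are projective. $\mathrm{Mat}(r+1,r+1)$ is the ring of real $(r+1)\times(r+1)$ matrices and $I$ its unit. For a function $f$ on $\mathbb{Z}^N$ (or on edges or elementary squares of a given direction), a subscript $i$ denotes the shift by one in the $i$-th coordinate: $f_i(n)=f(n+e_i)$; $f_{ij}=f_{ji}$. Superscripts are labels of coordinate directions. Grassmannian Q-net of rank $r$: a map $X:\mathbb{Z}^N\to\mathbb{G}^d_r$ such that the four $r$-planes $X,X_i,X_j,X_{ij}$ at the vertices of every elementary square lie in a $(3r+2)$-plane. General position means here: any three of the four $r$-planes at the vertices of each elementary square span a $(3r+2)$-plane; $\dim\operatorname{span}(X,X_i,X_j,X_k)=4r+3$ at every vertex for all pairwise distinct $i,j,k$ (so $d\ge 4r+3$); and every subspace $X(n)$ has a basis forming the rows of an $(r+1)\times(d+1)$ matrix $x(n)$ whose last $r+1$ columns form the unit matrix $I$ (this $x(n)$ is then unique). Coefficients: with this normalization there are matrices $a^{ij},a^{ji}\in\mathrm{Mat}(r+1,r+1)$, assigned to elementary squares parallel to the $(ij)$ coordinate plane, such that $$x_{ij}=x+a^{ij}(x_i-x)+a^{ji}(x_j-x).$$ General position implies that the $a^{ij}$ are invertible and $a^{ij}_ka^{ik}=a^{ik}_ja^{ij}$ for pairwise distinct $i,j,k$, so that there exist invertible matrices $h^i$, assigned to edges of $\mathbb{Z}^N$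 parallel to the $i$-th axis, with $a^{ij}=h^i_j(h^i)^{-1}$ for all $j\neq i$. Such $h^i$ are called discrete Lamé coefficients. The discrete rotation coefficients, assigned to elementary squares parallel to the $(ij)$ plane, are $$b^{ij}=(h^i_j)^{-1}(h^j_i-h^j),\qquad i\ne j.$$ (Equivalently, with $y^i$ defined by $x_i-x=h^iy^i$, one has $y^i_j=y^i+b^{ij}y^j$.) *)

(* Defs.v *)
From HB Require Import structures.
From mathcomp Require Import all_boot all_order all_algebra.
From mathcomp Require Import reals.

Set Implicit Arguments.
Unset Strict Implicit.
Unset Printing Implicit Defensive.

Import GRing.Theory.
Local Open Scope ring_scope.

(* Z^N is 'rV[int]_N; the shift of f in direction i is n |-> f (n + e i). *)
Definition e {N : nat} (i : 'I_N) : 'rV[int]_N := delta_mx 0 i.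

(* The r-planes of P^d, as (r+1)-dimensional subspaces of R^(d+1). Below, a
   projective dimension m appears as the vector space dimension m.+1. *)
Record grassmannian (R : fieldType) (d r : nat) := Grassmannian {
  plane :> {vspace 'rV[R]_d.+1};
  dim_plane : \dim plane = r.+1
}.

Definition pairwise_distinct3 {N : nat} (i j k : 'I_N) : bool :=
  [&& i != j, i != k & j != k].

Definition pairwise_distinct4 {N : nat} (i j k l : 'I_N) : bool :=
  [&& i != j, i != k, i != l, j != k, j != l & k != l].

Section QNets.

Variables (R : realType) (d r N : nat).
Variable X : 'rV[int]_N -> grassmannian R d r.

Definition Qnet : Prop :=
  forall (n : 'rV[int]_N) (i j : 'I_N), i != j ->
  exists P : {vspace 'rV[R]_d.+1},
    [/\ \dim P = (3 * r + 2).+1, (X n <= P)%VS, (X (n + e i) <= P)%VS,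
        (X (n + e j) <= P)%VS & (X (n + e i + e j) <= P)%VS].

(* The column of index d - r + l is a genuine column whenever r <= d, which
   holds as soon as grassmannian R d r is inhabited. *)
Definition last_cols (A : 'M[R]_(r.+1, d.+1)) : 'M[R]_r.+1 :=
  colsub (fun l : 'I_r.+1 => inord (d - r + l)) A.

Definition normalized_basis (V : {vspace 'rV[R]_d.+1})
    (A : 'M[R]_(r.+1, d.+1)) : Prop :=
  basis_of V [seq row k A | k : 'I_r.+1] /\ last_cols A = 1%:M.

Definition general_position : Prop :=
  [/\ forall (n : 'rV[int]_N) (i j : 'I_N), i != j ->
        [/\ \dim (X n + X (n + e i) + X (n + e j)) = (3 * r + 2).+1,
            \dim (X n + X (n + e i) + X (n + e i + e j)) = (3 * r + 2).+1,
            \dim (X n + X (n + e j) + X (n + e i + e j)) = (3 * r + 2).+1 &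
            \dim (X (n + e i) + X (n + e j) + X (n + e i + e j))
              = (3 * r + 2).+1],
      forall (n : 'rV[int]_N) (i j k : 'I_N), pairwise_distinct3 i j k ->
        \dim (X n + X (n + e i) + X (n + e j) + X (n + e k))
          = (4 * r + 3).+1 &
      forall n : 'rV[int]_N,
        exists A : 'M[R]_(r.+1, d.+1), normalized_basis (X n) A].

End QNets.

(* A quantity attached to edges (resp. elementary squares) of given directions
   is a function of the vertex n with the smallest coordinates. Families indexed
   by two directions are only meaningful for distinct directions. *)
Section Coefficients.

Variables (R : realType) (d r N : nat).

Definition net_coefficients (x : 'rV[int]_N -> 'M[R]_(r.+1, d.+1))
    (a : 'I_N -> 'I_N -> 'rV[int]_N -> 'M[R]_r.+1) : Prop :=
  forall (i j : 'I_N) (n : 'rV[int]_N), i != j ->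
    x (n + e i + e j) = x n + a i j n *m (x (n + e i) - x n)
                            + a j i n *m (x (n + e j) - x n).

Definition lame_coefficients (a : 'I_N -> 'I_N -> 'rV[int]_N -> 'M[R]_r.+1)
    (h : 'I_N -> 'rV[int]_N -> 'M[R]_r.+1) : Prop :=
  (forall i n, h i n \is a GRing.unit) /\
  (forall i j n, i != j -> a i j n = h i (n + e j) * (h i n)^-1).

Definition rotation_coefficients (h : 'I_N -> 'rV[int]_N -> 'M[R]_r.+1)
    (i j : 'I_N) (n : 'rV[int]_N) : 'M[R]_r.+1 :=
  (h i (n + e j))^-1 * (h j (n + e i) - h j n).

End Coefficients.

Section Darboux.

Variables (R : realType) (r N : nat).
Implicit Type b : 'I_N -> 'I_N -> 'M[R]_r.+1.

(* b^{ij}_k; since A^-1 = A for a singular matrix A, it has its intended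
   meaning only if darboux_denominator b j k is a unit. *)
Definition darboux_denominator b (j k : 'I_N) : 'M[R]_r.+1 :=
  1 - b j k * b k j.

Definition darboux_shift b (k : 'I_N) : 'I_N -> 'I_N -> 'M[R]_r.+1 :=
  fun i j => (b i j + b i k * b k j) * (darboux_denominator b j k)^-1.

(* Existence of the inverses involved in b^{ij}_{kl}: those of b^{ij}_k and
   b^{lj}_k, of b^{il}_k and b^{jl}_k, and of the outer formula. *)
Definition double_shift_defined b (j k l : 'I_N) : bool :=
  [&& darboux_denominator b j k \is a GRing.unit,
      darboux_denominator b l k \is a GRing.unit &
      darboux_denominator (darboux_shift b k) j l \is a GRing.unit].

End Darboux.

(* Main.v *)
Require Import Defs.
From HB Require Import structures.
From mathcomp Require Import all_boot all_order all_algebra.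
From mathcomp Require Import reals.
From mathcomp Require Import zify.

(** The proof of the first part follows the edge vectors
    y^i = (h^i)^-1 (x_i - x).  Substituting the Lamé factorisation
    a^ij = h^i_j (h^i)^-1 into the equation of the net turns it into the linear
    transport law  y^i_j = y^i + b^ij y^j  ([edge_vector_shift]).  Transporting
    y^i along j and k in the two possible orders gives
      b^ik y^k + b^ij_k (y^j + b^jk y^k) = b^ij y^j + b^ik_j (y^k + b^kj y^j).
    Three r-planes spanning a (3r+2)-plane are in direct sum, so the rows of y^j
    and y^k are linearly independent and coefficients may be compared:
      b^ij_k = b^ij + b^ik_j b^kj,    b^ik_j = b^ik + b^ij_k b^jk.
    Eliminating b^ik_j yields  b^ij_k (1 - b^jk b^kj) = b^ij + b^ik b^kj
    ([rotation_darboux]).  The factor 1 - b^jk b^kj is invertible because the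
    edges of the same square that end at its far vertex, carrying y^j_k and
    y^k_j, are independent as well: a row vector v killed by this factor gives
    the relation  v y^j_k - v b^jk y^k_j = 0  ([rotation_denominator_unit]).

    The second part is an identity in the ring of matrices.  If y^i is
    transported along j, k and l, the coefficient of y^j in the result can be
    computed in two ways, which suggests that C = b^ij_kl is a solution of
      C (1 - b^jk_l b^kj - b^jl_k b^lj) = b^ij + b^ik_l b^kj + b^il_k b^lj.
    This equation is symmetric in k and l, so b^ij_lk solves it too, and its
    solution is unique because the factor next to C is the unit
    (1 - b^jl_k b^lj_k) (1 - b^jk b^kj).  Both facts are in
    [double_shift_equation], and rest on the relation
    b^ik_l = b^ik + b^il_k b^lk  ([darboux_shift_cross]). *)

Set Implicit Arguments.
Unset Strict Implicit.
Unset Printing Implicit Defensive.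

Import GRing.Theory.
Local Open Scope ring_scope.

(** * Linear independence from dimensions of spans *)

Lemma addv_eq0_of_dim (K : fieldType) (vT : vectType K) (U V : {vspace vT})
    (m p : nat) (u v : vT) :
  (\dim U <= m)%N -> (\dim V <= p)%N -> \dim (U + V) = (m + p)%N ->
  u \in U -> v \in V -> u + v = 0 -> u = 0 /\ v = 0.
Proof.
move=> leU leV dimUV uU vV uv0.
have capUV: (U :&: V)%VS = 0%VS.
  apply/eqP; rewrite -dimv_eq0 -leqn0 -(leq_add2l (m + p)) addn0 -{1}dimUV.
  by rewrite dimv_sum_cap leq_add.
have uE: u = - v by apply/eqP; rewrite -addr_eq0 uv0.
have u0: u = 0.
  by apply/eqP; rewrite -memv0 -capUV memv_cap uU uE rpredN vV.
by split=> //; move: uv0; rewrite u0 add0r.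
Qed.

Section Independence.

Variables (R : realType) (d r : nat).

(** The unit block makes the rows of a normalized matrix independent: the last
    columns of [c *m A] are [c] itself. *)
Lemma normalized_mulmx_eq0 (q : nat) (c : 'M[R]_(q, r.+1))
    (A : 'M[R]_(r.+1, d.+1)) :
  last_cols A = 1%:M -> c *m A = 0 -> c = 0.
Proof.
move=> A1 cA0; rewrite -[c]mulmx1 -A1 /last_cols.
by rewrite mulmx_colsub cA0; apply/matrixP=> s t; rewrite !mxE.
Qed.

Lemma normalized_basis_mem (U : {vspace 'rV[R]_d.+1}) (A : 'M[R]_(r.+1, d.+1))
    (v : 'rV[R]_r.+1) :
  normalized_basis U A -> v *m A \in U.
Proof.
case=> /span_basis <- _; rewrite mulmx_sum_row.
apply: memv_suml => k _; apply/memvZ/memv_span.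
exact: image_f.
Qed.

(** Three r-planes that span a (3r+2)-plane are in direct sum, since
    3r+3 = 3(r+1); a relation between the differences is a relation
    between elements of the three summands. *)
Lemma differences_independent (U V W : grassmannian R d r)
    (A B C : 'M[R]_(r.+1, d.+1)) (q : nat) (s t : 'M[R]_(q, r.+1)) :
  normalized_basis U A -> normalized_basis V B -> normalized_basis W C ->
  \dim (U + V + W) = (3 * r + 2).+1 ->
  s *m (B - A) + t *m (C - A) = 0 -> s = 0 /\ t = 0.
Proof.
move=> hA hB hC dimUVW st0.
have dimUV: (\dim (U + V) <= r.+1 + r.+1)%N.
  by apply: leq_trans (dimv_add_leqif U V) _; rewrite !dim_plane.
have dimUVW': \dim (U + V + W) = (r.+1 + r.+1 + r.+1)%N.
  by rewrite dimUVW; lia.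
have dimUVE: \dim (U + V) = (r.+1 + r.+1)%N.
  apply/eqP; rewrite eqn_leq dimUV -(leq_add2r r.+1) -dimUVW'.
  by rewrite (leq_trans (dimv_add_leqif (U + V) W)) ?dim_plane.
have rows0 k : row k s *m B = 0 /\ row k t *m C = 0.
  have rk: - (row k s + row k t) *m A + row k s *m B + row k t *m C = 0.
    move/(congr1 (row k)): st0; rewrite raddfD raddf0 /= !row_mul => <-.
    by rewrite !mulmxBr mulNmx mulmxDl opprD -addrA addrC addrACA.
  have memUV: - (row k s + row k t) *m A + row k s *m B \in (U + V)%VS.
    by apply: memv_add; apply: normalized_basis_mem.
  have [uv0 ->] := addv_eq0_of_dim dimUV (eq_leq (dim_plane W)) dimUVW'
    memUV (normalized_basis_mem _ hC) rk.
  have [_ ->] := addv_eq0_of_dim (eq_leq (dim_plane U)) (eq_leq (dim_plane V))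
    dimUVE (normalized_basis_mem _ hA) (normalized_basis_mem _ hB) uv0.
  by [].
split; apply/row_matrixP=> k; rewrite row0; have [sB tC] := rows0 k.
  exact: normalized_mulmx_eq0 hB.2 sB.
exact: normalized_mulmx_eq0 hC.2 tC.
Qed.

End Independence.

(** * Edge vectors of a net and their transport *)

Section Net.

Variables (R : realType) (d r N : nat).
Variables (x : 'rV[int]_N -> 'M[R]_(r.+1, d.+1))
          (a : 'I_N -> 'I_N -> 'rV[int]_N -> 'M[R]_r.+1)
          (h : 'I_N -> 'rV[int]_N -> 'M[R]_r.+1).
Hypotheses (xa : net_coefficients x a) (ah : lame_coefficients a h).

Let b := rotation_coefficients h.

Definition edge_vector (i : 'I_N) (n : 'rV[int]_N) : 'M[R]_(r.+1, d.+1) :=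
  (h i n)^-1 *m (x (n + e i) - x n).

Lemma mul_edge_vector i n : h i n *m edge_vector i n = x (n + e i) - x n.
Proof. by rewrite mulmxA -[h i n *m _]/(_ * _) divrr ?mul1mx //; case: ah. Qed.

(** With a^ij = h^i_j (h^i)^-1 the equation of the net reads
    x_ij - x = h^i_j y^i + h^j_i y^j; subtracting x_j - x = h^j y^j leaves
    h^i_j y^i_j = h^i_j y^i + (h^j_i - h^j) y^j. *)
Lemma edge_vector_shift i j n : i != j ->
  edge_vector i (n + e j) = edge_vector i n + b i j n *m edge_vector j n.
Proof.
case: ah => hu aE ij.
have hb: h i (n + e j) *m b i j n = h j (n + e i) - h j n.
  by rewrite -[_ *m _]/(_ * _) mulrA divrr ?mul1r.
apply: (can_inj (mulKmx (hu i (n + e j)))).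
rewrite mul_edge_vector mulmxDr (mulmxA _ (b i j n)) hb mulmxBl mul_edge_vector.
have aM k l : k != l ->
    a k l n *m (x (n + e k) - x n) = h k (n + e l) *m edge_vector k n.
  by move=> kl; rewrite aE // -mulmxA.
rewrite addrAC xa // !aM //; last by rewrite eq_sym.
by rewrite opprB !addrA; congr (_ - _); rewrite [RHS]addrC addrA.
Qed.

Variable X : 'rV[int]_N -> grassmannian R d r.
Hypotheses (Xgp : general_position X)
           (xX : forall n, normalized_basis (X n) (x n)).

Lemma lame_mul_eq0 q i n (s : 'M[R]_(q, r.+1)) : s *m (h i n)^-1 = 0 -> s = 0.
Proof. by move=> s0; rewrite -[s](mulmxKV (ah.1 i n)) s0 mul0mx. Qed.

(** The two edges that start at [n], from the span of X, X_j, X_k. *)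
Lemma edge_vectors_independent (q : nat) (s t : 'M[R]_(q, r.+1)) j k n :
  j != k -> s *m edge_vector j n + t *m edge_vector k n = 0 ->
  s = 0 /\ t = 0.
Proof.
move=> jk; rewrite !mulmxA => st0; case: Xgp => /(_ n j k jk) [dimX _ _ _] _ _.
have [s0 t0] := differences_independent (xX _) (xX _) (xX _) dimX st0.
by split; [apply: lame_mul_eq0 s0 | apply: lame_mul_eq0 t0].
Qed.

(** The two edges that end at the far vertex of the square, from the span of
    X_j, X_k, X_jk. *)
Lemma opposite_edge_vectors_independent (q : nat) (s t : 'M[R]_(q, r.+1))
    j k n :
  j != k ->
  s *m edge_vector j (n + e k) + t *m edge_vector k (n + e j) = 0 ->
  s = 0 /\ t = 0.
Proof.
move=> jk; rewrite /edge_vector [n + e k + e j]addrAC !mulmxA => st0.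
case: Xgp => /(_ n j k jk) [_ _ _]; rewrite [(X _ + X _)%VS]addvC addvC addvA.
move=> dimX _ _.
(* Both edges are read backwards, with the far vertex as base point. *)
have st0' : - (s *m (h j (n + e k))^-1) *m (x (n + e k) - x (n + e j + e k))
    + - (t *m (h k (n + e j))^-1) *m (x (n + e j) - x (n + e j + e k)) = 0.
  by rewrite !mulNmx -!mulmxN !opprB.
have [/eqP] := differences_independent (xX _) (xX _) (xX _) dimX st0'.
rewrite oppr_eq0 => /eqP s0 /eqP; rewrite oppr_eq0 => /eqP t0.
by split; [apply: lame_mul_eq0 s0 | apply: lame_mul_eq0 t0].
Qed.

(** A left kernel vector v of 1 - b^jk b^kj gives a relation between opposite
    edge vectors, because v y^j_k - v b^jk y^k_j = v (1 - b^jk b^kj) y^j. *)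
Lemma rotation_denominator_unit j k n : j != k ->
  1 - b j k n * b k j n \is a GRing.unit.
Proof.
move=> jk; suff: row_free (1 - b j k n * b k j n) by rewrite row_free_unit.
rewrite -kermx_eq0; apply/eqP; set K := kermx _.
have K0 : K - K *m b j k n *m b k j n = 0.
  by rewrite -{1}[K]mulmx1 -mulmxA -mulmxBr; apply: mulmx_ker.
have [] // := @opposite_edge_vectors_independent _ K (- (K *m b j k n)) j k n jk.
rewrite !edge_vector_shift // 1?eq_sym //.
(* Abstracting the coefficients keeps [mulmxA] from unfolding them. *)
move: (b j k n) (b k j n) (edge_vector _ n) (edge_vector _ n) K K0.
move=> bjk bkj yj yk K K0; rewrite !mulmxDr !mulNmx !mulmxA.
by rewrite addrA addrK -mulmxBl K0 mul0mx.
Qed.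

(** Expansion of y^i_kj = y^i_jk over the independent y^j and y^k, followed by
    elimination of b^ik_j between the two coefficient equations. *)
Lemma rotation_darboux i j k n : pairwise_distinct3 i j k ->
  b i j (n + e k) * (1 - b j k n * b k j n) = b i j n + b i k n * b k j n.
Proof.
case/and3P=> ij ik jk; have kj : k != j by rewrite eq_sym.
have : edge_vector i (n + e k + e j) = edge_vector i (n + e j + e k).
  by rewrite addrAC.
rewrite !(edge_vector_shift _ ij, edge_vector_shift _ ik).
rewrite (edge_vector_shift _ jk) (edge_vector_shift _ kj).
rewrite -!addrA => /addrI E; have [] := @edge_vectors_independent _
  (b i j (n + e k) - (b i j n + b i k (n + e j) *m b k j n))
  (b i k n + b i j (n + e k) *m b j k n - b i k (n + e j)) j k n jk.
  (* Abstracting the coefficients keeps [mulmxA] from unfolding them. *)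
  move: E; move: (edge_vector j n) (edge_vector k n) => yj yk.
  move: (b i j n) (b i k n) (b j k n) (b k j n) (b i j _) (b i k _).
  move=> bij bik bjk bkj bij_k bik_j; rewrite !mulmxDr !mulmxA => E.
  rewrite !mulmxBl !mulmxDl addrACA -opprD; apply/eqP; rewrite subr_eq0.
  by rewrite addrCA E addrAC -addrA.
move=> /subr0_eq B1 /subr0_eq B2.
rewrite mulrBr mulr1 mulrA {1}B1 -B2 mulmxDl addrA; exact: addrK.
Qed.

End Net.

(** * Multidimensional consistency *)

Section Consistency.

Variables (R : realType) (r N : nat).
Implicit Types (b : 'I_N -> 'I_N -> 'M[R]_r.+1) (i j k l : 'I_N).

Lemma darboux_shiftM b i j k : darboux_denominator b j k \is a GRing.unit ->
  darboux_shift b k i j * darboux_denominator b j k = b i j + b i k * b k j.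
Proof. by move=> u; rewrite /darboux_shift divrK. Qed.

(** The equation from which the Darboux map is obtained by elimination, as in
    [rotation_darboux]; it is recovered here by multiplying by 1 - b^kl b^lk and
    moving that factor through b^lk as (1 - b^lk b^kl). *)
Lemma darboux_shift_cross b i k l :
  darboux_denominator b k l \is a GRing.unit ->
  darboux_denominator b l k \is a GRing.unit ->
  darboux_shift b l i k = b i k + darboux_shift b k i l * b l k.
Proof.
move=> ukl ulk; apply: (mulIr ukl); rewrite darboux_shiftM //.
have swap : b l k * darboux_denominator b k l
            = darboux_denominator b l k * b l k.
  by rewrite mulrBr mulrBl mulr1 mul1r mulrA.
rewrite [RHS]mulrDl -mulrA swap mulrA darboux_shiftM //.
by rewrite mulrBr mulr1 mulrDl !mulrA addrACA addNr addr0.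
Qed.

(** The right factor of b^ij_kl in [double_shift_equation]; the equation
    determines b^ij_kl when it is a unit, and it is symmetric in [k] and [l]. *)
Definition double_shift_factor b j k l : 'M[R]_r.+1 :=
  1 - darboux_shift b l j k * b k j - darboux_shift b k j l * b l j.

(** Transport of y^i along k, l and then j gives y^i_kl + C y^j_kl, where C is
    b^ij_kl; its expansion is y^i + C y^j + Q y^k + S y^l with
    Q = b^ik_l + C b^jk_l and S = b^il_k + C b^jl_k.  Transport along j first
    expresses the same vector through y^i_j, y^k_j, y^l_j, so that
    C = b^ij + Q b^kj + S b^lj, which is the equation. The computation below
    checks it directly: by [expand], each side is the corresponding side of the
    formula defining C, multiplied by 1 - b^jk b^kj. *)
Lemma double_shift_equation b i j k l :
  double_shift_defined b j k l ->
  darboux_denominator b k l \is a GRing.unit ->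
  double_shift_factor b j k l \is a GRing.unit /\
  darboux_shift (darboux_shift b k) l i j * double_shift_factor b j k l
    = b i j + darboux_shift b l i k * b k j + darboux_shift b k i l * b l j.
Proof.
case/and3P=> ujk ulk ujl ukl.
have expand m : darboux_shift b l m k * b k j + darboux_shift b k m l * b l j
    = b m k * b k j
      + darboux_shift b k m l * darboux_shift b k l j * darboux_denominator b j k.
  rewrite (darboux_shift_cross _ ukl ulk) -[X in _ = _ + X]mulrA.
  by rewrite darboux_shiftM // mulrDl mulrDr !mulrA -addrA [X in _ + X]addrC.
have factorE : double_shift_factor b j k l
    = darboux_denominator (darboux_shift b k) j l * darboux_denominator b j k.
  by rewrite /double_shift_factor -addrA -opprD expand opprD addrA mulrBl mul1r.
rewrite factorE unitrMl //; split=> //.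
rewrite mulrA darboux_shiftM // -addrA expand addrA -(darboux_shiftM _ ujk).
by rewrite mulrDl.
Qed.

Lemma darboux_shift_consistent b i j k l :
  double_shift_defined b j k l -> double_shift_defined b j l k ->
  darboux_shift (darboux_shift b k) l i j
    = darboux_shift (darboux_shift b l) k i j.
Proof.
move=> dkl dlk; have [[_ ulk _] [_ ukl _]] := (and3P dkl, and3P dlk).
have [u Ekl] := double_shift_equation i dkl ukl.
have [_ Elk] := double_shift_equation i dlk ulk.
have factorC : double_shift_factor b j l k = double_shift_factor b j k l.
  exact: addrAC.
by apply: (mulIr u); rewrite Ekl -factorC Elk addrAC.
Qed.

End Consistency.

Theorem theorem3 (R : realType) (r N : nat) (hN : (3 <= N)%N) :
  (forall (d : nat) (X : 'rV[int]_N -> grassmannian R d r),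
     Qnet X -> general_position X ->
     forall (x : 'rV[int]_N -> 'M[R]_(r.+1, d.+1))
            (a : 'I_N -> 'I_N -> 'rV[int]_N -> 'M[R]_r.+1)
            (h : 'I_N -> 'rV[int]_N -> 'M[R]_r.+1),
     (forall n : 'rV[int]_N, normalized_basis (X n) (x n)) ->
     net_coefficients x a ->
     lame_coefficients a h ->
     let b := rotation_coefficients h in
     forall (i j k : 'I_N) (n : 'rV[int]_N), pairwise_distinct3 i j k ->
       (1 - b j k n * b k j n) \is a GRing.unit /\
       b i j (n + e k)
         = (b i j n + b i k n * b k j n) * (1 - b j k n * b k j n)^-1)
  /\
  ((4 <= N)%N ->
     forall (b : 'I_N -> 'I_N -> 'M[R]_r.+1) (i j k l : 'I_N),
     pairwise_distinct4 i j k l ->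
     double_shift_defined b j k l -> double_shift_defined b j l k ->
     darboux_shift (darboux_shift b k) l i j
       = darboux_shift (darboux_shift b l) k i j).
Proof.
split=> [d X _ Xgp x a h xX xa ah b i j k n ijk | _ b i j k l _].
  have u : (1 - b j k n * b k j n) \is a GRing.unit.
    by case/and3P: ijk => _ _ jk; apply: (rotation_denominator_unit xa ah Xgp xX).
  by split=> //; rewrite -(rotation_darboux xa ah Xgp xX) // mulrK.
exact: darboux_shift_consistent.
Qed.
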